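(* Let $\alpha,\beta,\gamma\in\mathbb{Z}$ with $\gamma>0$ and $\alpha^\gamma\neq 1\neq\beta^\gamma$. Let $\mu$ be an integer that is inverse to $\beta$ modulo the order of $B$ in $G$, and let $N_0$ be the normal closure in $G$ of the $\gamma-1$ elements $$[A^{\alpha},B^{\mu}][A,B]^{-1},\ \dots,\ [A^{\alpha^{\gamma-1}},B^{\mu^{\gamma-1}}][A,B]^{-1}.$$ Then $$N=N_0,\qquad \delta=\gamma,\qquad |W|=\gamma|G|/|N_0|,$$ and $W$ is generated by elements $a,b,d$ subject to the defining relations $$a^{[a,b]}=a^{\alpha^\gamma},\quad {}^{[a,b]}b=b^{\beta^\gamma},\quad [a^\alpha,b^\mu]=[a,b],\ \dots,\ [a^{\alpha^{\gamma-1}},b^{\mu^{\gamma-1}}]=[a,b],$$ $$a^d=a^\alpha,\quad b^d=b^\mu\ (\text{that is, } {}^d b=b^\beta),\quad d^\gamma=[a,b].$$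
   Context: Conventions: $x^y=y^{-1}xy$, ${}^y x=yxy^{-1}$, $[x,y]=x^{-1}y^{-1}xy$. $W=\langle X,Y,Z\mid X^Z=X^\alpha,\ {}^Z Y=Y^\beta,\ Z^\gamma=[X,Y]\rangle$ is the Wamsley group, and $G=\langle A,B\mid A^{[A,B]}=A^{\alpha^\gamma},\ {}^{[A,B]}B=B^{\beta^\gamma}\rangle$ is the Macdonald group, which is known to be finite (and nilpotent). Since $B^{\beta^\gamma}$ and $B$ are conjugate, $\beta$ is relatively prime to the order of $B$, so $\mu$ exists. There is a homomorphism $\Omega:G\to W$ given by $A\mapsto X$, $B\mapsto Y$; $N$ denotes its kernel. The subgroup $\langle X,Y\rangle$ is normal in $W$ and $W/\langle X,Y\rangle$ is cyclic of finite order $\delta$ (a factor of $\gamma$). *)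

(* Defs.v *)
From HB Require Import structures.
From mathcomp Require Import all_boot all_order all_algebra.
From mathcomp Require Import mathcomp_extra boolp classical_sets functions.
From mathcomp Require Import cardinality.

Set Implicit Arguments.
Unset Strict Implicit.
Unset Printing Implicit Defensive.

Import GRing.Theory.

Local Open Scope group_scope.
Local Open Scope quotient_scope.
Local Open Scope classical_set_scope.

(* Conjugation and commutators are MathComp's: x ^ y = y^-1 x y and
   [~ x, y] = x^-1 y^-1 x y, so that y x y^-1 is written x ^ y^-1. *)

Definition expgz (G : groupType) (x : G) (m : int) : G :=
  match m with Posz n => x ^+ n | Negz n => x ^- n.+1 end.

Notation "x ^^ m" := (expgz x m)
  (at level 29, left associativity) : group_scope.

(* 0 for an element of infinite order, so that congruence modulo the order of
   x always amounts to equality of the powers of x. *)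
Definition gorder (G : groupType) (x : G) : nat :=
  match pselect (exists n, (0 < n)%N && (x ^+ n == 1)) with
  | left e => ex_minn e
  | right _ => 0%N
  end.

Section Subgroups.
Variable G : groupType.

Definition is_subgroup (H : set G) :=
  H 1 /\ forall x y, H x -> H y -> H (x * y^-1).

Definition is_normal (H : set G) :=
  is_subgroup H /\ forall x y, H x -> H (x ^ y).

Definition generated (S : set G) : set G := smallest is_subgroup S.

Definition normal_closure (S : set G) : set G := smallest is_normal S.

(* The cardinality of this set is the index of H, i.e. the order of G / H if H is normal. *)
Definition left_cosets (H : set G) : set (set G) :=
  [set [set x * h | h in H] | x in [set: G]].

Lemma normal_closure_normal (S : set G) : is_normal (normal_closure S).
Proof.
split; first split.
- by move=> H [[[]]].
- move=> x y Nx Ny H HS; case: (HS) => -[[_ HD] _] _.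
  by apply: HD; [apply: Nx | apply: Ny].
- move=> x y Nx H HS; case: (HS) => -[_ HJ] _.
  by apply: HJ; apply: Nx.
Qed.

Lemma sub_normal_closure (S : set G) : S `<=` normal_closure S.
Proof. by move=> x Sx H [_]; apply. Qed.

Section NormalTheory.
Variables (H : set G) (nH : is_normal H).

Lemma normal1 : H 1. Proof. by case: nH => -[]. Qed.

Lemma normalV x : H x -> H x^-1.
Proof. by case: nH => -[H1 HD] _ Hx; rewrite -[x^-1]mul1g; exact: HD. Qed.

Lemma normalM x y : H x -> H y -> H (x * y).
Proof.
move=> Hx Hy; rewrite -[y]invgK; case: nH => -[_ HD] _; apply: HD => //.
exact: normalV.
Qed.

Lemma normalJ x y : H x -> H (x ^ y).
Proof. by case: nH => _; apply. Qed.

End NormalTheory.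

End Subgroups.

Definition kernel (G H : groupType) (f : G -> H) : set G := [set x | f x = 1].

Section Quotient.
Variables (G : groupType) (S : set G).

Definition nc_rel (x y : G) : bool := `[< normal_closure S (x^-1 * y) >].

Let nS := normal_closure_normal S.

Lemma nc_rel_refl : reflexive nc_rel.
Proof. by move=> x; apply/asboolP; rewrite mulVg; exact: (normal1 nS). Qed.

Lemma nc_rel_sym : symmetric nc_rel.
Proof.
by move=> x y; apply/asboolP/asboolP => /(normalV nS); rewrite invgM invgK.
Qed.

Lemma nc_rel_trans : transitive nc_rel.
Proof.
move=> y x z /asboolP xy /asboolP yz; apply/asboolP.
by have := normalM nS xy yz; rewrite mulgA mulgK.
Qed.

Canonical nc_equiv := EquivRel nc_rel nc_rel_refl nc_rel_sym nc_rel_trans.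

(* The quotient of G by the normal closure of S. *)
Definition quotg := {eq_quot nc_equiv}.

HB.instance Definition _ := Choice.on quotg.

Definition quotg_pi (x : G) : quotg := \pi_{eq_quot nc_equiv} x.

Lemma quotg_piP x y :
  quotg_pi x = quotg_pi y <-> normal_closure S (x^-1 * y).
Proof.
split=> [xy|xy]; last exact/(@eqmodP _ nc_equiv)/asboolP.
by have /asboolP : nc_equiv x y by apply/(@eqmodP _ nc_equiv).
Qed.

Lemma quotg_reprK (q : quotg) : quotg_pi (repr q) = q.
Proof. exact: reprK. Qed.

Definition quotg_mul (p q : quotg) := quotg_pi (repr p * repr q).
Definition quotg_one := quotg_pi 1.
Definition quotg_inv (p : quotg) := quotg_pi (repr p)^-1.

Lemma quotg_piM x y : quotg_pi (x * y) = quotg_mul (quotg_pi x) (quotg_pi y).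
Proof.
apply/quotg_piP; set x' := repr _; set y' := repr _.
have xx : normal_closure S (x^-1 * x') by apply/quotg_piP; rewrite quotg_reprK.
have yy : normal_closure S (y^-1 * y') by apply/quotg_piP; rewrite quotg_reprK.
have -> : (x * y)^-1 * (x' * y') = (x^-1 * x') ^ y * (y^-1 * y').
  by rewrite /conjg invgM !mulgA mulgK.
by exact: (normalM nS (normalJ nS _ xx) yy).
Qed.

Lemma quotg_piV x : quotg_pi x^-1 = quotg_inv (quotg_pi x).
Proof.
apply/quotg_piP; set x' := repr _.
have xx : normal_closure S (x^-1 * x') by apply/quotg_piP; rewrite quotg_reprK.
have -> : x^-1^-1 * x'^-1 = ((x^-1 * x')^-1) ^ x^-1.
  by rewrite /conjg invgM !invgK !mulgA mulgK.
by exact: (normalJ nS _ (normalV nS xx)).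
Qed.

Lemma quotg_mulA : associative quotg_mul.
Proof.
move=> p q r; rewrite -[p]quotg_reprK -[q]quotg_reprK -[r]quotg_reprK.
by rewrite -!quotg_piM mulgA.
Qed.

Lemma quotg_mul1 : left_id quotg_one quotg_mul.
Proof. by move=> p; rewrite -[p]quotg_reprK -quotg_piM mul1g. Qed.

Lemma quotg_mulr1 : right_id quotg_one quotg_mul.
Proof. by move=> p; rewrite -[p]quotg_reprK -quotg_piM mulg1. Qed.

Lemma quotg_mulV : left_inverse quotg_one quotg_inv quotg_mul.
Proof. by move=> p; rewrite -[p]quotg_reprK -quotg_piV -quotg_piM mulVg. Qed.

Lemma quotg_mulrV : right_inverse quotg_one quotg_inv quotg_mul.
Proof. by move=> p; rewrite -[p]quotg_reprK -quotg_piV -quotg_piM mulgV. Qed.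

HB.instance Definition _ := isGroup.Build quotg
  quotg_mulA quotg_mul1 quotg_mulr1 quotg_mulV quotg_mulrV.

HB.instance Definition _ := isUMagmaMorphism.Build G quotg quotg_pi
  (erefl _, quotg_piM).

End Quotient.

Section FreeGroup.
Variable T : Type.

(* (t, true) stands for the letter t and (t, false) for its inverse. *)
Definition fword := seq (T * bool).

HB.instance Definition _ := gen_eqMixin fword.
HB.instance Definition _ := gen_choiceMixin fword.

Inductive fword_eq : fword -> fword -> Prop :=
| fword_eq_refl u : fword_eq u u
| fword_eq_sym u v : fword_eq u v -> fword_eq v u
| fword_eq_trans u v w : fword_eq u v -> fword_eq v w -> fword_eq u w
| fword_eq_cancel u v t b : fword_eq (u ++ [:: (t, b), (t, ~~ b) & v]) (u ++ v).

Definition fword_rel (u v : fword) : bool := `[< fword_eq u v >].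

Lemma fword_rel_refl : reflexive fword_rel.
Proof. by move=> u; apply/asboolP; constructor. Qed.

Lemma fword_rel_sym : symmetric fword_rel.
Proof. by move=> u v; apply/asboolP/asboolP => ?; exact: fword_eq_sym. Qed.

Lemma fword_rel_trans : transitive fword_rel.
Proof.
by move=> v u w /asboolP uv /asboolP vw; apply/asboolP; exact: fword_eq_trans vw.
Qed.

Canonical fword_equiv :=
  EquivRel fword_rel fword_rel_refl fword_rel_sym fword_rel_trans.

Definition free := {eq_quot fword_equiv}.

HB.instance Definition _ := Choice.on free.

Definition free_pi (u : fword) : free := \pi_{eq_quot fword_equiv} u.

Lemma free_piP u v : free_pi u = free_pi v <-> fword_eq u v.
Proof.
split=> [uv|uv]; last exact/(@eqmodP _ fword_equiv)/asboolP.
by have /asboolP : fword_equiv u v by apply/(@eqmodP _ fword_equiv).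
Qed.

Lemma free_reprK (p : free) : free_pi (repr p) = p.
Proof. exact: reprK. Qed.

Definition fword_inv (u : fword) : fword :=
  rev [seq (l.1, ~~ l.2) | l <- u].

Definition free_mul (p q : free) := free_pi (repr p ++ repr q).
Definition free_one := free_pi [::].
Definition free_inv (p : free) := free_pi (fword_inv (repr p)).

Lemma fword_eq_catl w u v : fword_eq u v -> fword_eq (w ++ u) (w ++ v).
Proof.
elim=> {u v} [u|u v _|u v x _ + _|u v t b].
- by constructor.
- exact: fword_eq_sym.
- exact: fword_eq_trans.
- by rewrite !catA; constructor.
Qed.

Lemma fword_eq_catr w u v : fword_eq u v -> fword_eq (u ++ w) (v ++ w).
Proof.
elim=> {u v} [u|u v _|u v x _ + _|u v t b].
- by constructor.
- exact: fword_eq_sym.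
- exact: fword_eq_trans.
- by rewrite -!catA; constructor.
Qed.

Lemma fword_eq_inv u v : fword_eq u v -> fword_eq (fword_inv u) (fword_inv v).
Proof.
elim=> {u v} [u|u v _|u v x _ + _|u v t b].
- by constructor.
- exact: fword_eq_sym.
- exact: fword_eq_trans.
- rewrite /fword_inv !map_cat !rev_cat /= !rev_cons -!cats1 -!catA /= negbK.
  exact: fword_eq_cancel.
Qed.

Lemma fword_invK : involutive fword_inv.
Proof.
move=> u; rewrite /fword_inv map_rev revK -map_comp -[RHS]map_id.
by apply: eq_map => -[t b] /=; rewrite negbK.
Qed.

Lemma fword_mulV u : fword_eq (u ++ fword_inv u) [::].
Proof.
elim: u => [|[t b] u IHu]; first by constructor.
have -> : ((t, b) :: u) ++ fword_inv ((t, b) :: u) =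
    [:: (t, b)] ++ (u ++ fword_inv u) ++ [:: (t, ~~ b)].
  by rewrite /fword_inv /= rev_cons -cats1 !catA.
apply: fword_eq_trans (fword_eq_catl _ (fword_eq_catr _ IHu)) _.
exact: (@fword_eq_cancel [::] [::] t b).
Qed.

Lemma free_piM u v : free_pi (u ++ v) = free_mul (free_pi u) (free_pi v).
Proof.
apply/free_piP; set u' := repr _; set v' := repr _.
have uu : fword_eq u u' by apply/free_piP; rewrite free_reprK.
have vv : fword_eq v v' by apply/free_piP; rewrite free_reprK.
exact: (fword_eq_trans (fword_eq_catr v uu) (fword_eq_catl u' vv)).
Qed.

Lemma free_piV u : free_pi (fword_inv u) = free_inv (free_pi u).
Proof.
by apply/free_piP/fword_eq_inv/free_piP; rewrite free_reprK.
Qed.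

Lemma free_mulA : associative free_mul.
Proof.
move=> p q r; rewrite -[p]free_reprK -[q]free_reprK -[r]free_reprK.
by rewrite -!free_piM catA.
Qed.

Lemma free_mul1 : left_id free_one free_mul.
Proof. by move=> p; rewrite -[p]free_reprK -free_piM. Qed.

Lemma free_mulr1 : right_id free_one free_mul.
Proof. by move=> p; rewrite -[p]free_reprK -free_piM cats0. Qed.

Lemma free_mulrV : right_inverse free_one free_inv free_mul.
Proof.
move=> p; rewrite -[p]free_reprK -free_piV -free_piM.
exact/free_piP/fword_mulV.
Qed.

Lemma free_mulV : left_inverse free_one free_inv free_mul.
Proof.
move=> p; rewrite -[p]free_reprK -free_piV -free_piM.
by apply/free_piP; have := fword_mulV (fword_inv (repr p)); rewrite fword_invK.
Qed.

HB.instance Definition _ := isGroup.Build free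
  free_mulA free_mul1 free_mulr1 free_mulV free_mulrV.

Definition fgen (t : T) : free := free_pi [:: (t, true)].

Section Lift.
Variables (H : groupType) (f : T -> H).

Definition fword_eval (u : fword) : H :=
  \prod_(l <- u) (if l.2 then f l.1 else (f l.1)^-1).

Lemma fword_eval_eq u v : fword_eq u v -> fword_eval u = fword_eval v.
Proof.
elim=> {u v} [//|u v _ ->//|u v w _ -> _ ->//|u v t b].
rewrite /fword_eval !big_cat /= !big_cons /=.
by case: b => /=; rewrite ?mulVKg ?mulKg ?mulgA ?mulgV ?mulVg ?mul1g ?mulgK ?mulgVK.
Qed.

Definition free_lift (p : free) : H := fword_eval (repr p).

Lemma free_lift_pi u : free_lift (free_pi u) = fword_eval u.
Proof. by apply/fword_eval_eq/free_piP; rewrite free_reprK. Qed.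

Lemma free_liftM : {morph free_lift : p q / p * q}.
Proof.
by move=> p q; rewrite [p * q]/(free_mul p q) free_lift_pi /fword_eval big_cat.
Qed.

Lemma free_lift1 : free_lift 1 = 1.
Proof. by apply: etrans (free_lift_pi [::]) _; rewrite /fword_eval big_nil. Qed.

HB.instance Definition _ := isUMagmaMorphism.Build free H free_lift
  (free_lift1, free_liftM).

Lemma free_lift_gen t : free_lift (fgen t) = f t.
Proof. by rewrite free_lift_pi /fword_eval big_seq1. Qed.

End Lift.

End FreeGroup.

Section Presentation.
Variables (T : Type) (E : seq (free T * free T)).

Definition relators : set (free T) := [set e.1 * e.2^-1 | e in [set` E]].

(* The group with set of generators T and relations u = v, (u, v) in E. *)
Definition presented := quotg relators.

HB.instance Definition _ := Group.on presented.

Definition pgen (t : T) : presented := quotg_pi relators (fgen t).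

Section Lift.
Variables (H : groupType) (f : T -> H).

Definition satisfies := forall e, e \in E -> free_lift f e.1 = free_lift f e.2.

Hypothesis fE : satisfies.

Lemma lift_normal_closure x :
  normal_closure relators x -> free_lift f x = 1.
Proof.
move=> /(_ (kernel (free_lift f))); apply; split; first split; first split.
- exact: gmulf1.
- by move=> y z; rewrite /kernel/= gmulfF/= => -> ->; rewrite mulgV.
- by move=> y z; rewrite /kernel/= gmulfJ/= => ->; rewrite conj1g.
- by move=> _ [e Ee <-]; rewrite /kernel/= gmulfF/= fE// mulgV.
Qed.

(* The homomorphism induced by f; it is well defined because of fE, on which its
   value does not depend. *)
Definition pres_lift of satisfies := fun q : presented =>
  free_lift f (repr q) : H.

Lemma pres_lift_pi x : pres_lift fE (quotg_pi relators x) = free_lift f x.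
Proof.
have xx : normal_closure relators (x^-1 * repr (quotg_pi relators x)).
  by apply/quotg_piP; rewrite quotg_reprK.
rewrite /pres_lift -[repr _](mulVKg x) gmulfM /=.
by rewrite (lift_normal_closure xx) mulg1.
Qed.

Lemma pres_liftM : {morph pres_lift fE : p q / p * q}.
Proof.
move=> p q; rewrite -[p]quotg_reprK -[q]quotg_reprK -gmulfM !pres_lift_pi.
exact: gmulfM.
Qed.

Lemma pres_lift1 : pres_lift fE 1 = 1.
Proof. exact: etrans (pres_lift_pi 1) (free_lift1 _). Qed.

HB.instance Definition _ := isUMagmaMorphism.Build presented H (pres_lift fE)
  (pres_lift1, pres_liftM).

Lemma pres_lift_gen t : pres_lift fE (pgen t) = f t.
Proof. by rewrite pres_lift_pi free_lift_gen. Qed.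

End Lift.

Lemma free_lift_pgen x : free_lift pgen x = quotg_pi relators x.
Proof.
rewrite -[x]free_reprK free_lift_pi /fword_eval.
elim: (repr x) => [|[t b] u IHu]; first by rewrite big_nil.
rewrite big_cons IHu -cat1s free_piM [RHS]gmulfM /=; congr (_ * _).
case: b => //; apply: etrans (esym (quotg_piV _ _)) _; congr quotg_pi.
exact: esym (free_piV [:: (t, true)]).
Qed.

Lemma pgenE : satisfies pgen.
Proof.
move=> e Ee; rewrite !free_lift_pgen; apply/esym/quotg_piP.
rewrite -[e.1 in X in _ X](mulgVK e.2) -conjgE.
apply: (normalJ (normal_closure_normal _)); apply: sub_normal_closure.
by exists e.
Qed.

(* The elements g t generate H, subject to the defining relations E. *)
Definition is_presentation (H : groupType) (g : T -> H) :=
  generated (range g) = [set: H] /\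
  kernel (free_lift g) = normal_closure relators.

End Presentation.

Variant gen2 := gen2_1 | gen2_2.
Variant gen3 := gen3_1 | gen3_2 | gen3_3.

Definition on_gen2 (U : Type) (a b : U) (t : gen2) : U :=
  match t with gen2_1 => a | gen2_2 => b end.

Definition on_gen3 (U : Type) (a b c : U) (t : gen3) : U :=
  match t with gen3_1 => a | gen3_2 => b | gen3_3 => c end.

Lemma gmulf_expgz (K H : groupType) (f : UMagmaMorphism.type K H) x m :
  f (x ^^ m) = f x ^^ m.
Proof. by case: m => n; rewrite /expgz ?gmulfV gmulfXn. Qed.

Lemma expgzN (H : groupType) (x : H) m : x ^^ (- m)%R = (x ^^ m)^-1.
Proof.
by case: m => [[|n]|n] //=; rewrite ?NegzE ?opprK /= ?invgK ?invg1.
Qed.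

Lemma expgzM (H : groupType) (x : H) m n : x ^^ (m * n)%R = (x ^^ m) ^^ n.
Proof.
have natM m' k : x ^^ (m' * Posz k)%R = (x ^^ m') ^^ k.
  case: m' => p; first by rewrite -PoszM /= expgnA.
  by rewrite NegzE mulNr !expgzN -PoszM /= expgnA expVgn.
by case: n => k //; rewrite NegzE mulrN !expgzN natM.
Qed.

Lemma conjg_expgz (H : groupType) (x z : H) m n :
  x ^ z = x ^^ m -> x ^ (z ^+ n) = x ^^ (m ^+ n)%R.
Proof.
move=> xz; elim: n => [|n IHn]; first by rewrite conjg1.
have conjX k : (x ^^ k) ^ z = (x ^ z) ^^ k.
  by case: k => k; rewrite /= ?conjVg conjXg.
by rewrite expgSr conjgM IHn conjX xz -expgzM exprS.
Qed.

Section Relations.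
Variables (alpha beta : int) (gamma : nat).

(* A relation u = v is encoded as the pair (u, v). *)
Definition macdonald_rels (H : groupType) (a b : H) : seq (H * H) :=
  [:: (a ^ [~ a, b], a ^^ (alpha ^+ gamma)%R);
      (b ^ [~ a, b]^-1, b ^^ (beta ^+ gamma)%R)].

Definition wamsley_rels (H : groupType) (x y z : H) : seq (H * H) :=
  [:: (x ^ z, x ^^ alpha); (y ^ z^-1, y ^^ beta); (z ^+ gamma, [~ x, y])].

Definition macdonald_presentation := macdonald_rels (fgen gen2_1) (fgen gen2_2).

Definition macdonald := presented macdonald_presentation.

HB.instance Definition _ := Group.on macdonald.

Definition macA : macdonald := pgen _ gen2_1.
Definition macB : macdonald := pgen _ gen2_2.

Definition wamsley_presentation :=
  wamsley_rels (fgen gen3_1) (fgen gen3_2) (fgen gen3_3).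

Definition wamsley := presented wamsley_presentation.

HB.instance Definition _ := Group.on wamsley.

Definition wamX : wamsley := pgen _ gen3_1.
Definition wamY : wamsley := pgen _ gen3_2.
Definition wamZ : wamsley := pgen _ gen3_3.

Lemma wamsley_relX : wamX ^ wamZ = wamX ^^ alpha.
Proof.
have /pgenE /= : nth (1, 1) wamsley_presentation 0 \in wamsley_presentation.
  by rewrite /= !inE eqxx ?orbT.
by rewrite gmulfJ gmulf_expgz /= !free_lift_gen.
Qed.

Lemma wamsley_relY : wamY ^ wamZ^-1 = wamY ^^ beta.
Proof.
have /pgenE /= : nth (1, 1) wamsley_presentation 1 \in wamsley_presentation.
  by rewrite /= !inE eqxx ?orbT.
by rewrite gmulfJ gmulf_expgz gmulfV /= !free_lift_gen.
Qed.

Lemma wamsley_relZ : wamZ ^+ gamma = [~ wamX, wamY].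
Proof.
have /pgenE /= : nth (1, 1) wamsley_presentation 2 \in wamsley_presentation.
  by rewrite /= !inE eqxx ?orbT.
by rewrite gmulfR gmulfXn /= !free_lift_gen.
Qed.

Lemma Omega_subproof : satisfies macdonald_presentation (on_gen2 wamX wamY).
Proof.
move=> e; rewrite !inE => /orP[] /eqP -> /=.
all: rewrite gmulfJ gmulf_expgz ?gmulfV gmulfR /= !free_lift_gen /=.
  by rewrite -wamsley_relZ; exact/conjg_expgz/wamsley_relX.
by rewrite -wamsley_relZ -expVgn; exact/conjg_expgz/wamsley_relY.
Qed.

Definition Omega : macdonald -> wamsley := pres_lift Omega_subproof.

HB.instance Definition _ := UMagmaMorphism.on Omega.

(* The relation tying b to d is left as a parameter, since it can be written in
   two ways. *)
Definition extension_rels (mu : int) (H : groupType) (a b d : H)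
    (b_rel : H * H) : seq (H * H) :=
  macdonald_rels a b
  ++ [seq ([~ a ^^ (alpha ^+ i)%R, b ^^ (mu ^+ i)%R], [~ a, b])
     | i <- iota 1 gamma.-1]
  ++ [:: (a ^ d, a ^^ alpha); b_rel; (d ^+ gamma, [~ a, b])].

Lemma OmegaA : Omega macA = wamX. Proof. exact: pres_lift_gen. Qed.
Lemma OmegaB : Omega macB = wamY. Proof. exact: pres_lift_gen. Qed.

End Relations.

Arguments Omega : clear implicits.

(* Main.v *)
Require Import Defs.
From HB Require Import structures.
From mathcomp Require Import all_boot all_order all_algebra.
From mathcomp Require Import mathcomp_extra boolp classical_sets functions.
From mathcomp Require Import cardinality.

Set Implicit Arguments.
Unset Strict Implicit.
Unset Printing Implicit Defensive.

Local Open Scope group_scope.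
Local Open Scope classical_set_scope.
Local Open Scope card_scope.

(** Write c for [[~ A, B]], or for its image in a quotient of G.

    In W, conjugation by Z sends X to X^alpha and Y to Y^mu (because
    Y^(mu beta) = Y), and it fixes Z^gamma = [X, Y]; hence all the commutators
    [X^(alpha^i), Y^(mu^i)] are equal, which is the inclusion of N0 in N
    ([wamsley_commutator]).

    For the converse, let a, b be the images of A, B in G / N0. For each
    i < gamma the pair a^(alpha^i), b^(mu^i) has commutator c and satisfies the
    Macdonald relations, so there is a homomorphism psi_i from G to G / N0
    sending A, B to that pair ([twist]); psi_0 is the projection. If G / N0 were
    known to embed in an extension generated by it and an element d with
    a^d = a^alpha, b^d = b^mu, d^gamma = c, left multiplication would permute
    the elements d^i g, with x d^i g = d^i psi_i(x) g. These formulas define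
    permutations of I_gamma x G / N0 without any reference to the extension: G
    acts on the i-th copy through psi_i ([trans]), and d moves each copy to the
    next one, the last one going back to the first through multiplication by c
    ([shift]). The Wamsley relations are checked directly
    ([induced_subproof]), whence an action of W. An element x of G in N acts
    trivially, and on (0, 1) it acts as psi_0(x); so x is in N0
    ([kernel_Omega_sub]).

    The index of <X, Y> is read on the homomorphism [degree] from W to Z/gamma
    that kills X and Y and sends Z to 1. It is onto, and as every element of W
    has the form Z^k h with h in <X, Y> ([wamsley_expZ]), its kernel is <X, Y>,
    that is, the range of Omega. The relation between the cardinalities of W,
    G and N0 follows by choosing sections of [degree] and of Omega
    ([card_extension]). Finally the two extended presentations and the Wamsley
    presentation have the same consequences, since the generators of each group
    satisfy the relations of the other ([extension_presentation]).

    No finiteness of G is used: when B has infinite order, the hypothesis on mu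
    says that mu beta = 1, and B^(mu beta) = B in all cases. *)

(** * Integer powers *)

Lemma expgzJ (H : groupType) (x z : H) m : (x ^^ m) ^ z = (x ^ z) ^^ m.
Proof. by case: m => k; rewrite /= ?conjVg conjXg. Qed.

Lemma expgz_succ (H : groupType) (x : H) m : x ^^ (m + 1)%R = x ^^ m * x.
Proof.
case: m => n; first by rewrite -PoszD addn1 /= expgSr.
have -> : (Negz n + 1 = - Posz n)%R.
  by rewrite NegzE intS GRing.opprD GRing.addrAC GRing.addNr GRing.add0r.
by rewrite expgzN /= expgS invgM mulgVK.
Qed.

Lemma expgz_one (H : groupType) m : (1 : H) ^^ m = 1.
Proof. by case: m => n; rewrite /= expg1n ?invg1. Qed.

Lemma expg_gorder (H : groupType) (x : H) : x ^+ gorder x = 1.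
Proof.
rewrite /gorder; case: pselect => [e|//].
by case: ex_minnP => n /andP[_ /eqP].
Qed.

Lemma expgz_eq1mod (H : groupType) (x : H) m :
  (m = 1 %[mod gorder x])%Z -> x ^^ m = x.
Proof.
move=> /eqP; rewrite eqz_mod_dvd => /dvdzP[q mq].
have -> : m = (Posz (gorder x) * q + 1)%R.
  by rewrite GRing.mulrC -mq GRing.subrK.
by rewrite expgz_succ expgzM /= expg_gorder expgz_one mul1g.
Qed.

Lemma expgz_fix_exp (H : groupType) (x : H) m n :
  x ^^ m = x -> x ^^ (m ^+ n)%R = x.
Proof. by move=> xm; elim: n => [//|n IHn]; rewrite GRing.exprS expgzM xm. Qed.

(** If conjugation by [z] raises [x] to the power [m], then conjugation by
    [z^-1] raises it to any power inverse to [m] for [x]. *)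
Lemma conjgV_expgz (H : groupType) (x z : H) m n :
  x ^ z = x ^^ m -> x ^^ (m * n)%R = x -> x ^ z^-1 = x ^^ n.
Proof.
move=> xz xmn; apply: (@conjg_inj _ z); rewrite conjgKV.
by rewrite expgzJ xz -expgzM.
Qed.

(** * Subgroups, kernels and generation *)

Section Subgroup.
Variables (G : groupType) (H : set G).
Hypothesis sH : is_subgroup H.

Lemma subgroup1 : H 1. Proof. by case: sH. Qed.

Lemma subgroupV x : H x -> H x^-1.
Proof. by case: sH => H1 HD Hx; rewrite -[x^-1]mul1g; exact: HD. Qed.

Lemma subgroupM x y : H x -> H y -> H (x * y).
Proof.
by move=> Hx /subgroupV Hy; rewrite -[y]invgK; case: sH => _; apply.
Qed.

Lemma subgroupX x n : H x -> H (x ^+ n).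
Proof.
move=> Hx; elim: n => [|n IHn]; first exact: subgroup1.
by rewrite expgS; exact: subgroupM.
Qed.

Lemma subgroup_expgz x m : H x -> H (x ^^ m).
Proof. by move=> Hx; case: m => n; [|apply: subgroupV]; exact: subgroupX. Qed.

Lemma subgroupR x y : H x -> H y -> H [~ x, y].
Proof.
by move=> Hx Hy; do ![apply: subgroupM|apply: subgroupV|assumption].
Qed.

End Subgroup.

Lemma generated_subgroup (G : groupType) (S : set G) :
  is_subgroup (generated S).
Proof.
split=> [K [[]]//|x y Sx Sy K SK]; case: (SK) => -[_ KD] _.
by apply: KD; [apply: Sx|apply: Sy].
Qed.

Lemma kernel_normal (G H : groupType) (f : UMagmaMorphism.type G H) :
  is_normal (kernel f).
Proof.
split; first split; first exact: gmulf1.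
- by move=> x y; rewrite /kernel/= gmulfF => -> ->; rewrite mulgV.
- by move=> x y; rewrite /kernel/= gmulfJ => ->; rewrite conj1g.
Qed.

Lemma equalizer_subgroup (G H : groupType) (f g : UMagmaMorphism.type G H) :
  is_subgroup [set x | f x = g x].
Proof.
split=> [|x y] /=; first by rewrite !gmulf1.
by rewrite !gmulfF => -> ->.
Qed.

Lemma preimage_subgroup (G H : groupType) (f : UMagmaMorphism.type G H) K :
  is_subgroup K -> is_subgroup (f @^-1` K).
Proof.
move=> sK; split=> [|x y] /=; first by rewrite gmulf1; exact: subgroup1.
by move=> Kx Ky; rewrite gmulfF; exact: (sK.2).
Qed.

Lemma range_subgroup (G H : groupType) (f : UMagmaMorphism.type G H) :
  is_subgroup (range f).
Proof.
split; first by exists 1 => //; exact: gmulf1.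
by move=> _ _ [x _ <-] [y _ <-]; exists (x * y^-1) => //; rewrite gmulfF.
Qed.

Lemma quotg_pi_eq1 (G : groupType) (S : set G) x :
  quotg_pi S x = 1 <-> normal_closure S x.
Proof.
split=> [/esym/quotg_piP|Sx]; first by rewrite invg1 mul1g.
by apply/esym/quotg_piP; rewrite invg1 mul1g.
Qed.

Lemma generated_pgen (T : Type) (E : seq (Defs.free T * Defs.free T)) :
  generated (range (pgen E)) = [set: presented E].
Proof.
apply/seteqP; split=> // q _.
have sP := generated_subgroup (range (pgen E)).
have -> : q = free_lift (pgen E) (repr q).
  by rewrite free_lift_pgen quotg_reprK.
rewrite /free_lift /fword_eval.
elim: (repr _) => [|[t b] u IHu].
  by rewrite big_nil; exact: (subgroup1 sP).
have St : generated (range (pgen E)) (pgen E t).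
  by apply: sub_gen_smallest; exists t.
rewrite big_cons; apply: (subgroupM sP) => //.
by case: b => //; exact: (subgroupV sP).
Qed.

(** A subgroup of a presented group containing the generators is everything. *)
Lemma presented_ind (T : Type) (E : seq (Defs.free T * Defs.free T))
    (K : set (presented E)) :
  is_subgroup K -> (forall t, K (pgen E t)) -> forall x, K x.
Proof.
move=> sK Kgen x; have : generated (range (pgen E)) x.
  by rewrite generated_pgen.
by apply: smallest_sub => // _ [t _ <-].
Qed.

(** Relations which hold between the generators of a presented group are
    consequences of its defining relations. *)
Lemma sub_closure_relators (T : Type) (E F : seq (Defs.free T * Defs.free T)) :
  satisfies E (pgen F) ->
  normal_closure (relators E) `<=` normal_closure (relators F).
Proof.
move=> EF x /(lift_normal_closure EF).
by rewrite free_lift_pgen => /quotg_pi_eq1.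
Qed.

Lemma is_presentation_pgen (T : Type) (E F : seq (Defs.free T * Defs.free T)) :
  satisfies E (pgen F) -> satisfies F (pgen E) -> is_presentation F (pgen E).
Proof.
move=> EF FE; split; first exact: generated_pgen.
have -> : normal_closure (relators F) = normal_closure (relators E).
  by apply/seteqP; split; exact: sub_closure_relators.
by apply/seteqP; split=> x; rewrite /kernel /= free_lift_pgen quotg_pi_eq1.
Qed.

(** * The group of bijections of a type *)

(** The bijections of [T], which need not be finite; the inverse is part of the
    data, and is determined by the function ([bijgP]). *)
Record bijg (T : Type) := Bijg {
  bijg_fun :> T -> T;
  bijg_inv : T -> T;
  bijg_funK : cancel bijg_fun bijg_inv;
  bijg_invK : cancel bijg_inv bijg_fun }.

HB.instance Definition _ (T : Type) := gen_eqMixin (bijg T).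
HB.instance Definition _ (T : Type) := gen_choiceMixin (bijg T).

Section BijGroup.
Variable T : Type.
Implicit Types p q r : bijg T.

Lemma bijgP p q : p =1 q -> p = q.
Proof.
case: p q => [p p' pK p'K] [q q' qK q'K] /= /funext epq; subst q.
have epq' : p' = q' by apply/funext => x; rewrite -{1}[x]q'K pK.
subst q'; congr Bijg; exact: Prop_irrelevance.
Qed.

Definition bijg_one : bijg T := @Bijg T id id (fun=> erefl) (fun=> erefl).

(** Composition, the right factor acting first. *)
Definition bijg_mul p q : bijg T :=
  Bijg (can_comp (@bijg_funK _ p) (@bijg_funK _ q))
       (can_comp (@bijg_invK _ q) (@bijg_invK _ p)).

Definition bijg_V p : bijg T := Bijg (@bijg_invK _ p) (@bijg_funK _ p).

Lemma bijg_mulA : associative bijg_mul.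
Proof. by move=> p q r; exact: bijgP. Qed.
Lemma bijg_mul1 : left_id bijg_one bijg_mul.
Proof. by move=> p; exact: bijgP. Qed.
Lemma bijg_mulr1 : right_id bijg_one bijg_mul.
Proof. by move=> p; exact: bijgP. Qed.
Lemma bijg_mulV : left_inverse bijg_one bijg_V bijg_mul.
Proof. by move=> p; apply: bijgP => x; exact: bijg_funK. Qed.
Lemma bijg_mulrV : right_inverse bijg_one bijg_V bijg_mul.
Proof. by move=> p; apply: bijgP => x; exact: bijg_invK. Qed.

HB.instance Definition _ := isGroup.Build (bijg T)
  bijg_mulA bijg_mul1 bijg_mulr1 bijg_mulV bijg_mulrV.

Lemma bijgM p q x : (p * q) x = p (q x). Proof. by []. Qed.

End BijGroup.

(** * Induced permutation representations *)

Section Induced.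
Variables (G K : groupType) (n : nat).
Variables (psi : 'I_n.+1 -> UMagmaMorphism.type G K) (c : K).

Local Notation T := ('I_n.+1 * K)%type.

Lemma trans_can x : cancel (fun u : T => (u.1, psi u.1 x * u.2))
                           (fun u : T => (u.1, psi u.1 x^-1 * u.2)).
Proof. by move=> [i g] /=; rewrite mulgA -gmulfM mulVg gmulf1 mul1g. Qed.

Lemma trans_canV x : cancel (fun u : T => (u.1, psi u.1 x^-1 * u.2))
                            (fun u : T => (u.1, psi u.1 x * u.2)).
Proof. by move=> [i g] /=; rewrite mulgA -gmulfM mulgV gmulf1 mul1g. Qed.

(** The bijection (i, g) |-> (i, psi_i(x) g). *)
Definition trans x : bijg T := Bijg (trans_can x) (trans_canV x).

Lemma transE x i g : trans x (i, g) = (i, psi i x * g). Proof. by []. Qed.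

Lemma transM : {morph trans : x y / x * y}.
Proof.
by move=> x y; apply: bijgP => -[i g]; rewrite bijgM /= gmulfM mulgA.
Qed.

Lemma trans1 : trans 1 = 1.
Proof. by apply: bijgP => -[i g] /=; rewrite gmulf1 mul1g. Qed.

HB.instance Definition _ := isUMagmaMorphism.Build G (bijg T) trans
  (trans1, transM).

(** (i, g) |-> (i + 1, g) for i < n, and (n, g) |-> (0, c g). *)
Definition shift_fun (u : T) : T :=
  if u.1 == ord_max then (ord0, c * u.2) else (inord u.1.+1, u.2).

Definition shift_inv (u : T) : T :=
  if u.1 == ord0 then (ord_max, c^-1 * u.2) else (inord u.1.-1, u.2).

Lemma ord_lt_max (i : 'I_n.+1) : i != ord_max -> (i.+1 < n.+1)%N.
Proof.
by move=> im; rewrite ltnS ltn_neqAle -ltnS ltn_ord andbT.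
Qed.

Lemma shift_funK : cancel shift_fun shift_inv.
Proof.
move=> [i g]; rewrite /shift_fun /=; have [->|im] := eqVneq i ord_max.
  by rewrite /shift_inv /= mulKg.
rewrite /shift_inv /= -val_eqE /= inordK ?ord_lt_max //=.
by rewrite inord_val.
Qed.

Lemma shift_invK : cancel shift_inv shift_fun.
Proof.
move=> [i g]; rewrite /shift_inv /=; have [->|i0] := eqVneq i ord0.
  by rewrite /shift_fun /= eqxx mulVKg.
have i_gt0 : (0 < i)%N by rewrite lt0n.
have i_lt : (i.-1 < n)%N by rewrite -ltnS prednK.
rewrite /shift_fun /= -val_eqE /= inordK ?(ltnW i_lt) // ?ltnS;
  last exact: ltnW.
by rewrite (ltn_eqF i_lt) prednK // inord_val.
Qed.

Definition shift : bijg T := Bijg shift_funK shift_invK.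

Lemma shiftE i g : i != ord_max -> shift (i, g) = (inord i.+1, g).
Proof. by rewrite /shift /= /shift_fun /= => /negbTE ->. Qed.

Lemma shift_max g : shift (ord_max, g) = (ord0, c * g).
Proof. by rewrite /shift /= /shift_fun /= eqxx. Qed.

(** Conjugation by the shift induces x |-> y on the translations whenever it
    does so from each copy to the next one; passing from the last copy to the
    first one involves [c]. *)
Lemma shift_conj x y :
    (forall i : 'I_n.+1, i != ord_max -> psi (inord i.+1) x = psi i y) ->
    psi ord0 x * c = c * psi ord_max y ->
  trans x ^ shift = trans y.
Proof.
move=> xy cxy; rewrite conjgE; apply: (mulgI shift); rewrite mulVKg.
apply: bijgP => -[i g]; rewrite !bijgM.
have [->|im] := eqVneq i ord_max.
  by rewrite transE !shift_max transE !mulgA cxy.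
by rewrite transE !shiftE // transE xy.
Qed.

Lemma shift_exp0 k g : (k < n.+1)%N -> (shift ^+ k) (ord0, g) = (inord k, g).
Proof.
elim: k => [_|k IHk lekn].
  by congr pair; apply: val_inj; rewrite /= inordK.
rewrite expgS bijgM IHk 1?ltnW // shiftE ?inordK 1?ltnW //.
by rewrite -val_eqE /= inordK 1?ltnW // neq_ltn -ltnS lekn.
Qed.

Lemma shift_expS x : (forall i, psi i x = c) -> shift ^+ n.+1 = trans x.
Proof.
move=> psic; have shift0 g : (shift ^+ n.+1) (ord0, g) = (ord0, c * g).
  rewrite expgS bijgM shift_exp0 //.
  have -> : inord n = ord_max :> 'I_n.+1 by apply: val_inj; rewrite /= inordK.
  by rewrite shift_max.
apply: bijgP => -[i g].
(* (i, g) is the image of (0, g) by a power of the shift, which commutes with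
   its (n + 1)-st power. *)
have shift_i h : (shift ^+ i) (ord0, h) = (i, h).
  by rewrite shift_exp0 // inord_val.
rewrite -{1}[(i, g)]shift_i -bijgM -expgnDr addnC expgnDr bijgM shift0 shift_i.
by rewrite /= psic.
Qed.

End Induced.

(** * Relations in a target group *)

Section Satisfies.
Variables (T : Type) (H : groupType) (f : T -> H).
Implicit Types E F : seq (Defs.free T * Defs.free T).

Lemma satisfies_cons e E :
  satisfies (e :: E) f <->
  free_lift f e.1 = free_lift f e.2 /\ satisfies E f.
Proof.
split=> [fE|[fe fE] e']; last by rewrite inE => /predU1P[->//|/fE].
split=> [|e' e'E]; first by apply: fE; rewrite mem_head.
by apply: fE; rewrite inE e'E orbT.
Qed.

Lemma satisfies_cat E F :
  satisfies (E ++ F) f <-> satisfies E f /\ satisfies F f.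
Proof.
split=> [fEF|[fE fF] e]; last by rewrite mem_cat => /orP[/fE|/fF].
by split=> e eE; apply: fEF; rewrite mem_cat eE ?orbT.
Qed.

End Satisfies.

Section PresentationRelations.
Variables (alpha beta : int) (gamma : nat).

(** The next three lemmas read the defining relations in the target group; the
    images of the generators are named through equations, so that the relations
    appear in their usual form. *)
Lemma satisfies_macdonald (H : groupType) (f : gen2 -> H) :
  satisfies (macdonald_presentation alpha beta gamma) f <->
  (forall a b, a = f gen2_1 -> b = f gen2_2 ->
    a ^ [~ a, b] = a ^^ (alpha ^+ gamma)%R /\
    b ^ [~ a, b]^-1 = b ^^ (beta ^+ gamma)%R).
Proof.
rewrite /macdonald_presentation /macdonald_rels !satisfies_cons /=.
rewrite !gmulfJ !gmulf_expgz gmulfV gmulfR /= !free_lift_gen.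
split=> [[? [? _]] a b -> ->//|fE].
by have [? ?] := fE _ _ erefl erefl; do !split.
Qed.

Lemma satisfies_wamsley (H : groupType) (f : gen3 -> H) :
  satisfies (wamsley_presentation alpha beta gamma) f <->
  (forall x y z, x = f gen3_1 -> y = f gen3_2 -> z = f gen3_3 ->
    [/\ x ^ z = x ^^ alpha, y ^ z^-1 = y ^^ beta & z ^+ gamma = [~ x, y]]).
Proof.
rewrite /wamsley_presentation /wamsley_rels !satisfies_cons /=.
rewrite !gmulfJ !gmulf_expgz gmulfV gmulfR gmulfXn /= !free_lift_gen.
split=> [[? [? [? _]]] x y z -> -> ->//|fE].
by have [? ? ?] := fE _ _ _ erefl erefl erefl; do !split.
Qed.

Lemma satisfies_extension (mu : int) (H : groupType) (f : gen3 -> H) r :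
  (0 < gamma)%N ->
  satisfies (extension_rels alpha beta gamma mu
    (fgen gen3_1) (fgen gen3_2) (fgen gen3_3) r) f <->
  (forall a b d, a = f gen3_1 -> b = f gen3_2 -> d = f gen3_3 ->
    [/\ a ^ [~ a, b] = a ^^ (alpha ^+ gamma)%R /\
          b ^ [~ a, b]^-1 = b ^^ (beta ^+ gamma)%R,
        (forall i, (1 <= i < gamma)%N ->
          [~ a ^^ (alpha ^+ i)%R, b ^^ (mu ^+ i)%R] = [~ a, b]),
        a ^ d = a ^^ alpha,
        free_lift f r.1 = free_lift f r.2 &
        d ^+ gamma = [~ a, b]]).
Proof.
move=> gamma_gt0; rewrite /extension_rels /macdonald_rels.
rewrite !satisfies_cat !satisfies_cons /=.
rewrite !gmulfJ !gmulf_expgz gmulfV !gmulfR gmulfXn /= !free_lift_gen.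
pose rel i := ([~ fgen gen3_1 ^^ (alpha ^+ i)%R, fgen gen3_2 ^^ (mu ^+ i)%R],
  [~ fgen gen3_1, fgen gen3_2]).
have -> : satisfies [seq rel i | i <- iota 1 gamma.-1] f <->
    (forall i, (1 <= i < gamma)%N ->
      [~ f gen3_1 ^^ (alpha ^+ i)%R, f gen3_2 ^^ (mu ^+ i)%R] =
      [~ f gen3_1, f gen3_2]).
  split=> [fE i i_gamma|fE _ /mapP[i i_gamma ->]] /=; last first.
    rewrite !gmulfR !gmulf_expgz /= !free_lift_gen; apply: fE.
    by rewrite mem_iota add1n prednK in i_gamma.
  have /fE : rel i \in [seq rel i | i <- iota 1 gamma.-1].
    by apply/mapP; exists i => //; rewrite mem_iota add1n prednK.
  by rewrite /= !gmulfR !gmulf_expgz /= !free_lift_gen.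
split=> [[[? [? _]] [? [? [? [? _]]]]] a b d -> -> ->//|fE].
by have [[? ?] ? ? ? ?] := fE _ _ _ erefl erefl erefl; do !split.
Qed.

Lemma macdonald_relA : let A := macA alpha beta gamma in
  let B := macB alpha beta gamma in A ^ [~ A, B] = A ^^ (alpha ^+ gamma)%R.
Proof.
have /satisfies_macdonald E :=
  pgenE (E := macdonald_presentation alpha beta gamma).
by have [] := E _ _ erefl erefl.
Qed.

Lemma macdonald_relB : let A := macA alpha beta gamma in
  let B := macB alpha beta gamma in B ^ [~ A, B]^-1 = B ^^ (beta ^+ gamma)%R.
Proof.
have /satisfies_macdonald E :=
  pgenE (E := macdonald_presentation alpha beta gamma).
by have [] := E _ _ erefl erefl.
Qed.

End PresentationRelations.

(** * The exponent mu *)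

Section WamsleyExtension.
Variables (alpha beta mu : int) (gamma : nat).
Hypothesis mu_inv :
  ((mu * beta)%R = 1 %[mod gorder (macB alpha beta gamma)])%Z.

Local Notation A := (macA alpha beta gamma).
Local Notation B := (macB alpha beta gamma).
Local Notation X := (wamX alpha beta gamma).
Local Notation Y := (wamY alpha beta gamma).
Local Notation Z := (wamZ alpha beta gamma).
Local Notation Om := (Omega alpha beta gamma).

Lemma macB_expz_mu_beta : B ^^ (mu * beta)%R = B.
Proof. exact: expgz_eq1mod. Qed.

Lemma wamY_expz_mu_beta : Y ^^ (mu * beta)%R = Y.
Proof. by rewrite -OmegaB -gmulf_expgz macB_expz_mu_beta. Qed.

(** Elements subject to the Macdonald relations are images of A and B. *)
Lemma macdonald_expz_mu_beta (H : groupType) (a b : H) :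
  a ^ [~ a, b] = a ^^ (alpha ^+ gamma)%R ->
  b ^ [~ a, b]^-1 = b ^^ (beta ^+ gamma)%R -> b ^^ (mu * beta)%R = b.
Proof.
move=> ab ba; have fE :
    satisfies (macdonald_presentation alpha beta gamma) (on_gen2 a b).
  by apply/satisfies_macdonald => _ _ -> ->.
have <- : pres_lift fE B = b by exact: pres_lift_gen.
by rewrite -gmulf_expgz macB_expz_mu_beta.
Qed.

Lemma conjg_expz_mu (H : groupType) (y z : H) :
  y ^^ (mu * beta)%R = y -> y ^ z^-1 = y ^^ beta <-> y ^ z = y ^^ mu.
Proof.
move=> ymb; split=> yz; last exact: conjgV_expgz yz ymb.
by rewrite -[z]invgK; apply: conjgV_expgz yz _; rewrite GRing.mulrC.
Qed.

Lemma wamY_conjZ : Y ^ Z = Y ^^ mu.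
Proof.
by apply/conjg_expz_mu; [exact: wamY_expz_mu_beta|exact: wamsley_relY].
Qed.

(** The left side is the conjugate of [X, Y] = Z^gamma by Z^i. *)
Lemma wamsley_commutator i :
  [~ X ^^ (alpha ^+ i)%R, Y ^^ (mu ^+ i)%R] = [~ X, Y].
Proof.
rewrite -(conjg_expgz i (wamsley_relX _ _ _)) -(conjg_expgz i wamY_conjZ).
rewrite -conjRg -wamsley_relZ; apply/conjg_fixP/commgP.
by apply: commuteX2; exact: commute_refl.
Qed.

Lemma macdonald_conjB : B ^ [~ A, B] = B ^^ (mu ^+ gamma)%R.
Proof.
rewrite -[[~ A, B]]invgK; apply: conjgV_expgz (macdonald_relB _ _ _) _.
rewrite -GRing.exprMn GRing.mulrC; exact: expgz_fix_exp macB_expz_mu_beta.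
Qed.

(** The two forms of the relation between b and d are covered by letting [r] be
    any relation equivalent to ^d b = b^beta when b^(mu beta) = b. *)
Lemma extension_presentation r :
    (0 < gamma)%N ->
    (forall (H : groupType) (f : gen3 -> H),
      f gen3_2 ^^ (mu * beta)%R = f gen3_2 ->
      free_lift f r.1 = free_lift f r.2 <->
      f gen3_2 ^ (f gen3_3)^-1 = f gen3_2 ^^ beta) ->
  is_presentation
    (extension_rels alpha beta gamma mu
      (fgen gen3_1) (fgen gen3_2) (fgen gen3_3) r)
    (pgen (wamsley_presentation alpha beta gamma)).
Proof.
move=> gamma_gt0 r_beta; apply: is_presentation_pgen.
  have /satisfies_extension E := pgenE (E := extension_rels alpha beta gamma mu
    (fgen gen3_1) (fgen gen3_2) (fgen gen3_3) r).
  have [[ab ba] _ ad rE dg] := E gamma_gt0 _ _ _ erefl erefl erefl.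
  apply/satisfies_wamsley => _ _ _ -> -> ->; split=> //.
  by apply/(r_beta _ _ _).1 => //; exact: macdonald_expz_mu_beta ab ba.
apply/satisfies_extension => // _ _ _ -> -> ->; split.
- rewrite -[pgen _ gen3_1]OmegaA -[pgen _ gen3_2]OmegaB.
  rewrite -!(gmulf_expgz Om) -!(gmulfR Om) -(gmulfV Om) -!(gmulfJ Om).
  by rewrite macdonald_relA macdonald_relB.
- by move=> i _; exact: wamsley_commutator.
- exact: wamsley_relX.
- by apply/r_beta; [exact: wamY_expz_mu_beta|exact: wamsley_relY].
- exact: wamsley_relZ.
Qed.

End WamsleyExtension.

(** * The kernel and the range of Omega *)

Section Kernel.
Variables (alpha beta mu : int) (n : nat).
Local Notation gamma := n.+1.
Hypothesis mu_inv :
  ((mu * beta)%R = 1 %[mod gorder (macB alpha beta gamma)])%Z.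

Local Notation G := (macdonald alpha beta gamma).
Local Notation W := (wamsley alpha beta gamma).
Local Notation A := (macA alpha beta gamma).
Local Notation B := (macB alpha beta gamma).
Local Notation X := (wamX alpha beta gamma).
Local Notation Y := (wamY alpha beta gamma).
Local Notation Z := (wamZ alpha beta gamma).
Local Notation Om := (Omega alpha beta gamma).
Local Notation H := (generated [set X; Y]).

Section Target.
Variables (K : groupType) (f : UMagmaMorphism.type G K).
Hypothesis f_comm : forall i, (1 <= i < gamma)%N ->
  [~ f A ^^ (alpha ^+ i)%R, f B ^^ (mu ^+ i)%R] = [~ f A, f B].

Local Notation a := (f A).
Local Notation b := (f B).
Local Notation c := [~ a, b].

Let ac : a ^ c = a ^^ (alpha ^+ gamma)%R.
Proof. by rewrite -gmulfR -gmulfJ macdonald_relA gmulf_expgz. Qed.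

Let bc : b ^ c = b ^^ (mu ^+ gamma)%R.
Proof. by rewrite -gmulfR -gmulfJ (macdonald_conjB mu_inv) gmulf_expgz. Qed.

Let bcV : b ^ c^-1 = b ^^ (beta ^+ gamma)%R.
Proof. by rewrite -gmulfR -gmulfV -gmulfJ macdonald_relB gmulf_expgz. Qed.

Let b_mu_beta : b ^^ (mu * beta)%R = b.
Proof. by rewrite -gmulf_expgz macB_expz_mu_beta. Qed.

Let twist_comm (i : 'I_gamma) : [~ a ^^ (alpha ^+ i)%R, b ^^ (mu ^+ i)%R] = c.
Proof. by case: (posnP i) => [->//|i_gt0]; rewrite f_comm ?i_gt0 /=. Qed.

Lemma twist_subproof (i : 'I_gamma) :
  satisfies (macdonald_presentation alpha beta gamma)
    (on_gen2 (a ^^ (alpha ^+ i)%R) (b ^^ (mu ^+ i)%R)).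
Proof.
apply/satisfies_macdonald => _ _ -> -> /=; rewrite twist_comm.
by rewrite !expgzJ ac bcV -!expgzM ![(_ ^+ gamma * _)%R]GRing.mulrC.
Qed.

(** The homomorphism sending A to a^(alpha^i) and B to b^(mu^i). *)
Definition twist i : UMagmaMorphism.type G K := pres_lift (twist_subproof i).

Lemma twistA i : twist i A = a ^^ (alpha ^+ i)%R.
Proof. exact: pres_lift_gen. Qed.

Lemma twistB i : twist i B = b ^^ (mu ^+ i)%R.
Proof. exact: pres_lift_gen. Qed.

Lemma twist0 : twist ord0 =1 f.
Proof.
apply: presented_ind (equalizer_subgroup _ _) _ => -[] /=.
  exact: etrans (twistA ord0) _.
exact: etrans (twistB ord0) _.
Qed.

Lemma induced_subproof :
  satisfies (wamsley_presentation alpha beta gamma)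
    (on_gen3 (trans twist A) (trans twist B) (shift n c)).
Proof.
apply/satisfies_wamsley => _ _ _ -> -> -> /=; split.
- rewrite -gmulf_expgz; apply: shift_conj => [i im|].
    by rewrite gmulf_expgz !twistA inordK ?ord_lt_max // GRing.exprSr expgzM.
  (* From the last copy to the first one: a c = c a^c. *)
  rewrite gmulf_expgz !twistA -expgzM -GRing.exprSr /= -ac.
  exact: conjgC.
- (* Equivalently, conjugation by the shift sends the action of B^beta to that
     of B. *)
  rewrite -gmulf_expgz; apply: (@conjg_inj _ (shift n c)); rewrite conjgKV.
  apply/esym; apply: shift_conj => [i im|].
    rewrite gmulf_expgz !twistB inordK ?ord_lt_max //.
    rewrite GRing.exprS -expgzM -GRing.mulrA [(_ * beta)%R]GRing.mulrC.
    by rewrite GRing.mulrA expgzM b_mu_beta.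
  rewrite gmulf_expgz !twistB [LHS]conjgC.
rewrite expgzJ /= bc -expgzM GRing.exprS.
  rewrite -GRing.mulrA [(_ * beta)%R]GRing.mulrC GRing.mulrA expgzM.
  by rewrite b_mu_beta.
- rewrite -[RHS]gmulfR; apply: shift_expS => i.
  by rewrite gmulfR /= twistA twistB twist_comm.
Qed.

(** Evaluate the induced action of W at (0, 1). *)
Lemma kernel_Omega_sub : kernel Om `<=` kernel f.
Proof.
pose rho : UMagmaMorphism.type W _ := pres_lift induced_subproof.
have rhoO : forall x, rho (Om x) = trans twist x.
  pose rhoOm : UMagmaMorphism.type G _ := rho \o Om.
  have := @presented_ind _ _ _ (equalizer_subgroup rhoOm (trans twist)).
  apply=> -[] /=; first by rewrite [Om _]OmegaA /rho /= [LHS]pres_lift_gen.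
  by rewrite [Om _]OmegaB /rho /= [LHS]pres_lift_gen.
move=> x Ox; have := rhoO x.
rewrite [Om x]Ox gmulf1 => /(congr1 (fun p : bijg _ => (p (ord0, 1)).2)).
by rewrite transE /= mulg1 twist0 => /esym.
Qed.

End Target.

Lemma kernel_Omega :
  kernel Om = normal_closure
    [set [~ A ^^ (alpha ^+ i)%R, B ^^ (mu ^+ i)%R] * [~ A, B]^-1
    | i in [set i : nat | (1 <= i < gamma)%N]].
Proof.
apply/seteqP; split; last first.
  apply: smallest_sub; first exact: kernel_normal.
  move=> _ [i _ <-]; have := wamsley_commutator mu_inv i.
  rewrite -OmegaA -OmegaB -!(gmulf_expgz Om) -!(gmulfR Om).
  move=> OR; rewrite /kernel /= gmulfF; apply/eqP; rewrite divg_eq1.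
  exact/eqP.
set S := [set _ | _ in _].
apply: subset_trans (@kernel_Omega_sub _ (quotg_pi S) _) _ => [i i_gamma|x].
  apply: divg1_eq; rewrite -!(gmulf_expgz (quotg_pi S)).
  rewrite -!(gmulfR (quotg_pi S)) -gmulfF.
  by apply/quotg_pi_eq1; apply: sub_normal_closure; exists i.
by move=> /quotg_pi_eq1.
Qed.

Lemma range_Omega : range Om = H.
Proof.
have sH := generated_subgroup [set X; Y].
apply/seteqP; split; last first.
  apply: smallest_sub; first exact: range_subgroup.
  by move=> _ [] ->; [exists A; rewrite ?OmegaA|exists B; rewrite ?OmegaB].
suff OH x : H (Om x) by move=> _ [x _ <-].
apply: (@presented_ind _ _ (Om @^-1` H)) (preimage_subgroup _ sH) _ x.
case=> /=; rewrite ?[Om _]OmegaA ?[Om _]OmegaB; apply: sub_gen_smallest.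
  by left.
by right.
Qed.

Lemma conjZ_sub h : H h -> H (h ^ Z).
Proof.
have sH := generated_subgroup [set X; Y].
have HX : H X by apply: sub_gen_smallest; left.
have HY : H Y by apply: sub_gen_smallest; right.
apply: (@smallest_sub _ _ _ [set h | H (h ^ Z)]) h => [|_ [] ->] /=.
- split=> [|x y] /=; first by rewrite conj1g; exact: (subgroup1 sH).
  by rewrite conjMg conjVg; exact: (sH.2).
- by rewrite wamsley_relX; exact: (subgroup_expgz sH).
- by rewrite (wamY_conjZ mu_inv); exact: (subgroup_expgz sH).
Qed.

Lemma conjXZ_sub k h : H h -> H (h ^ (Z ^+ k)).
Proof.
move=> Hh; elim: k => [|k IHk]; first by rewrite conjg1.
by rewrite expgSr conjgM; exact: conjZ_sub.
Qed.

(** Non-negative exponents suffice since Z^gamma is in <X, Y>. *)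
Lemma wamsley_expZ w : exists k h, H h /\ w = Z ^+ k * h.
Proof.
have sH := generated_subgroup [set X; Y].
have HR : H [~ X, Y].
  by apply: (subgroupR sH); apply: sub_gen_smallest; [left|right].
apply: (@presented_ind _ _ [set w | exists k h, H h /\ w = Z ^+ k * h]) w.
  split=> [|_ _ [i [h [Hh ->]]] [j [k [Hk ->]]]] /=.
    by exists 0%N, 1; split; [exact: (subgroup1 sH)|rewrite mulg1].
  (* Z^-j = Z^((gamma - 1) j) e with e in <X, Y>. *)
  pose e := (Z ^+ (gamma * j))^-1.
  have He : H e.
    apply: (subgroupV sH); rewrite expgnA wamsley_relZ; exact: (subgroupX sH).
  have Zj : (Z ^+ j)^-1 = Z ^+ (n * j) * e.
    by rewrite /e mulSn expgnDr invgM mulVKg.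
  exists (i + n * j)%N, ((h * k^-1) ^ (Z ^+ (n * j)) * e); split.
    by apply: (subgroupM sH) => //; apply: conjXZ_sub; exact: (sH.2).
  rewrite invgM Zj expgnDr conjgE !mulgA; do !congr (_ * _).
  by rewrite mulgK.
case=> /=.
- by exists 0%N, X; split; [apply: sub_gen_smallest; left|rewrite mul1g].
- by exists 0%N, Y; split; [apply: sub_gen_smallest; right|rewrite mul1g].
- by exists 1%N, 1; split; [exact: (subgroup1 sH)|rewrite mulg1].
Qed.

Lemma degree_subproof :
  satisfies (wamsley_presentation alpha beta gamma)
    (on_gen3 (1 : 'I_gamma) 1 Zp1).
Proof.
apply/satisfies_wamsley => _ _ _ -> -> -> /=.
rewrite !conj1g !expgz_one comm1g; split=> //.
by rewrite Zp_expg; apply: val_inj; rewrite /= modnMl.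
Qed.

(** The exponent sum of Z modulo gamma; the group law of ['I_gamma] is addition
    modulo gamma. *)
Definition degree : UMagmaMorphism.type W 'I_gamma := pres_lift degree_subproof.

Lemma degreeX : degree X = 1. Proof. exact: pres_lift_gen. Qed.
Lemma degreeY : degree Y = 1. Proof. exact: pres_lift_gen. Qed.
Lemma degreeZ : degree Z = Zp1. Proof. exact: pres_lift_gen. Qed.

Lemma range_degree : range degree = setT.
Proof.
apply/seteqP; split=> // i _; exists (Z ^+ i) => //.
by rewrite gmulfXn degreeZ Zp1_expgz.
Qed.

Lemma kernel_degree : kernel degree = H.
Proof.
have sH := generated_subgroup [set X; Y].
have HK : H `<=` kernel degree.
  apply: smallest_sub; first exact: (kernel_normal degree).1.
  by move=> _ [] ->; [exact: degreeX|exact: degreeY].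
apply/seteqP; split=> // w; have [k [h [Hh ->]]] := wamsley_expZ w.
rewrite /kernel /= gmulfM gmulfXn degreeZ (HK _ Hh) mulg1.
rewrite Zp_expg => /(congr1 val) /=; rewrite modnMml mul1n => /eqP /dvdnP[q ->].
apply: (subgroupM sH) => //; rewrite mulnC expgnA wamsley_relZ.
apply: (subgroupX sH).
by apply: (subgroupR sH); apply: sub_gen_smallest; [left|right].
Qed.

End Kernel.

(** * Cardinalities *)

Lemma set_bij_card_eq (T U : Type) (A : set T) (B : set U) (f : T -> U) :
  set_bij A B f -> A #= B.
Proof.
case=> fAB f_inj fBA; have <- : f @` A = B.
  by apply/seteqP; split=> // _ [x /fAB ? <-].
by rewrite card_eq_sym; exact: inj_card_eq.
Qed.

Lemma set_bijX (T T' U U' : Type) (A : set T) (A' : set T')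
    (B : set U) (B' : set U') (f : T -> T') (g : U -> U') :
  set_bij A A' f -> set_bij B B' g ->
  set_bij (A `*` B) (A' `*` B') (fun p => (f p.1, g p.2)).
Proof.
move=> [fA f_inj fA'] [gB g_inj gB']; split.
- by move=> [x y] [/= /fA ? /gB ?]; split.
- move=> [x y] [x' y'] /set_mem[/= Ax By] /set_mem[/= Ax' By'] [xx' yy'].
  by congr pair; [apply: f_inj|apply: g_inj] => //; exact: mem_set.
- move=> [x' y'] [/= /fA'[x Ax <-] /gB'[y By <-]]; by exists (x, y).
Qed.

Lemma card_setX_II (T U : Type) (A : set T) (B : set U) m n :
  A #= `I_m -> B #= `I_n -> A `*` B #= `I_(m * n).
Proof.
move=> /card_set_bijP[f fA] /card_set_bijP[g gB].
apply: card_eq_trans (set_bij_card_eq (set_bijX fA gB)) _.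
apply: (@set_bij_card_eq _ _ _ _ (fun p => p.1 * n + p.2)%N); split.
- move=> [i j] [/= im jn]; apply: leq_trans (_ : i.+1 * n <= _)%N.
    by rewrite mulSn addnC ltn_add2r.
  by rewrite leq_mul2r im orbT.
- move=> [i j] [i' j'] /set_mem[/= _ jn] /set_mem[/= _ jn'] E.
  have n_gt0 : (0 < n)%N by apply: leq_ltn_trans jn.
  congr pair; last by have := congr1 (modn^~ n) E; rewrite !modnMDl !modn_small.
  by have := congr1 (divn^~ n) E; rewrite !divnMDl // !divn_small // !addn0.
- move=> k /= k_lt; have n_gt0 : (0 < n)%N.
    by rewrite lt0n; apply: contraTneq k_lt => ->; rewrite muln0.
  exists (k %/ n, k %% n)%N; last by rewrite /= -divn_eq.
  by split; rewrite /= ?ltn_divLR // ltn_mod.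
Qed.

Section Counting.
Variables (W Q : groupType) (q : UMagmaMorphism.type W Q).

(* A section of q on its range. *)
Let s (y : Q) : W := xget 1 [set w | q w = y].

Let qs w : q (s (q w)) = q w.
Proof. by apply: (@xgetPex _ 1 [set v | q v = q w]); exists w. Qed.

Lemma card_left_cosets_kernel : left_cosets (kernel q) #= range q.
Proof.
have -> : left_cosets (kernel q) =
    (fun y => [set s y * h | h in kernel q]) @` range q.
  apply/seteqP; split=> [_ [w _ <-]|_ [_ [w _ <-] <-]];
    last by exists (s (q w)).
  exists (q w); first by exists w.
  have sw : q (w^-1 * s (q w)) = 1 by rewrite gmulfM gmulfV qs mulVg.
  apply/seteqP; split=> _ [h qh <-].
    exists (w^-1 * s (q w) * h); last by rewrite -mulgA mulVKg.
    by rewrite /kernel /= gmulfM sw qh mulg1.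
  exists ((w^-1 * s (q w))^-1 * h).
    by rewrite /kernel /= gmulfM gmulfV sw qh invg1 mulg1.
  by rewrite invgM invgK -!mulgA mulVKg.
apply: inj_card_eq => _ _ /set_mem[v _ <-] /set_mem[w _ <-] E.
have : [set s (q w) * h | h in kernel q] (s (q v)).
  by rewrite -E; exists 1; [exact: gmulf1|rewrite mulg1].
by move=> [h qh] /(congr1 q); rewrite gmulfM !qs qh mulg1.
Qed.

(** If the range of [f] is the kernel of [q], then W and G have respectively the
    cardinalities of range q x range f and range f x ker f. *)
Lemma card_extension (G : groupType) (f : UMagmaMorphism.type G W) :
    kernel q = range f ->
  [set: W] `*` kernel f #= range q `*` [set: G].
Proof.
(* t is a section of f; the bijection is
   (w, k) |-> (q w, t (s (q w)^-1 w) k). *)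
move=> qf; pose t w : G := xget 1 [set g | f g = w].
have ft w : q w = 1 -> f (t w) = w.
  rewrite -[q w = 1]/(kernel q w) qf => -[g _ gw].
  by apply: (@xgetPex _ 1 [set g | f g = w]); exists g.
have qf1 g : q (f g) = 1 by rewrite -[_ = 1]/(kernel q (f g)) qf; exists g.
pose r w := (s (q w))^-1 * w.
have fr w : f (t (r w)) = r w by apply: ft; rewrite gmulfM gmulfV qs mulVg.
apply: (@set_bij_card_eq _ _ _ _ (fun p => (q p.1, t (r p.1) * p.2))); split.
- by move=> [w k] _; split=> //=; exists w.
- move=> [v j] [w k] /set_mem[/= _ fj] /set_mem[/= _ fk] [qvw E].
  have vw : v = w.
    have := congr1 f E; rewrite !gmulfM !fr fj fk !mulg1 /r qvw.
    exact: mulgI.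
  by congr pair => //; move: E; rewrite vw; exact: mulgI.
- move=> [_ g] [/= [w _ <-] _]; pose v := s (q w) * f g.
  have qv : q v = q w by rewrite gmulfM qs qf1 mulg1.
  have rv : r v = f g by rewrite /r qv mulKg.
  exists (v, (t (r v))^-1 * g); last by rewrite /= qv mulVKg.
  by split=> //; rewrite /kernel /= gmulfM gmulfV fr rv mulVg.
Qed.

End Counting.

(** * Structure of the Wamsley group *)

Theorem theorem2p2 (alpha beta : int) (gamma : nat) (mu : int)
  (gamma_gt0 : (0 < gamma)%N)
  (alpha_neq1 : (alpha ^+ gamma)%R <> 1%R)
  (beta_neq1 : (beta ^+ gamma)%R <> 1%R)
  (mu_inv : ((mu * beta)%R = 1 %[mod gorder (macB alpha beta gamma)])%Z) :
  let G : groupType := macdonald alpha beta gamma in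
  let A : G := macA alpha beta gamma in
  let B : G := macB alpha beta gamma in
  let W : groupType := wamsley alpha beta gamma in
  let X : W := wamX alpha beta gamma in
  let Y : W := wamY alpha beta gamma in
  let N : set G := kernel (Omega alpha beta gamma) in
  let N0 : set G :=
    normal_closure
      [set [~ A ^^ (alpha ^+ i)%R, B ^^ (mu ^+ i)%R] * [~ A, B]^-1
      | i in [set i : nat | (1 <= i < gamma)%N]] in
  [/\ N = N0,
      left_cosets (generated [set X; Y]) #= `I_gamma,
      [set: W] `*` N0 #= `I_gamma `*` [set: G]
      /\ (forall g n : nat, [set: G] #= `I_g -> N0 #= `I_n ->
            [set: W] #= `I_((gamma * g) %/ n))
    & exists a b d : W,
        let fa := fgen gen3_1 in
        let fb := fgen gen3_2 in
        let fd := fgen gen3_3 in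
        is_presentation
          (extension_rels alpha beta gamma mu fa fb fd (fb ^ fd, fb ^^ mu))
          (on_gen3 a b d)
        /\ is_presentation
             (extension_rels alpha beta gamma mu fa fb fd
                (fb ^ fd^-1, fb ^^ beta))
             (on_gen3 a b d)].
Proof.
case: gamma gamma_gt0 alpha_neq1 beta_neq1 mu_inv => // n _ _ _ mu_inv /=.
set N0 := normal_closure _.
have NN0 : kernel (Omega alpha beta n.+1) = N0 by exact: kernel_Omega.
have cardWN : [set: wamsley alpha beta n.+1] `*` N0 #=
    `I_n.+1 `*` [set: macdonald alpha beta n.+1].
  rewrite -NN0.
  apply: card_eq_trans (card_extension (q := degree alpha beta n) _) _.
    by rewrite range_Omega (kernel_degree mu_inv).
  rewrite range_degree.
  apply: set_bij_card_eq (set_bijX (f := val) (g := id) _ _).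
    split=> [i _|i j _ _|i i_lt] /=; [exact: ltn_ord|exact: val_inj|].
    by exists (Ordinal i_lt).
  by split=> // g _; exists g.
split=> //.
- rewrite -(kernel_degree mu_inv).
  apply: card_eq_trans (card_left_cosets_kernel _) _.
  by rewrite range_degree card_eq_sym card_II.
- split=> // g k Gg Nk.
  have N01 : N0 1 by exact: normal1 (normal_closure_normal _).
  have WNfin := card_eq_trans cardWN (card_setX_II (card_eqxx `I_n.+1) Gg).
  have [w Ww] : finite_set [set: wamsley alpha beta n.+1].
    have : finite_set ([set: wamsley alpha beta n.+1] `*` N0).
      by exists (n.+1 * g)%N.
    move=> /(finite_image fst); congr (finite_set _).
    by apply/seteqP; split=> // v _; exists (v, 1).
  (* N0 is not empty, so that division by its cardinality k is legitimate. *)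
  have k_gt0 : (0 < k)%N.
    rewrite lt0n; apply/eqP => k0.
    move: Nk; rewrite k0 II0 card_eq0 => /eqP N00.
    by move: N01; rewrite N00.
  have := card_setX_II Ww Nk; rewrite card_eq_sym => WN.
  have /card_eq_II <- := card_eq_trans WN WNfin.
  by rewrite mulnK.
exists (wamX alpha beta n.+1), (wamY alpha beta n.+1), (wamZ alpha beta n.+1).
have -> : on_gen3 (wamX alpha beta n.+1) (wamY alpha beta n.+1)
    (wamZ alpha beta n.+1) = pgen (wamsley_presentation alpha beta n.+1).
  by apply/funext => -[].
split; apply: extension_presentation => // H f f_mu_beta /=.
  rewrite gmulfJ gmulf_expgz /= !free_lift_gen.
  by apply: iff_sym; exact: conjg_expz_mu f_mu_beta.
by rewrite gmulfJ gmulf_expgz gmulfV /= !free_lift_gen.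
Qed.
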